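(* Let $n\ge1$. The homomorphism $\psi:\mathbb{Z}[\mathcal{GQ}_{2n}]\to H^*(\mathcal{GQ}_{2n})$, which sends each generator $M_v$ and $\Delta_K$ to the function on $V_{2n}$ denoted by the same symbol, is an isomorphism; that is, $\mathbb{Z}[\mathcal{GQ}_{2n}]\simeq H^{*}(\mathcal{GQ}_{2n})$.
   Context: **GKM graph $\mathcal{GQ}_{2n}$.** Vertices $V_{2n}=[2n+2]=\{1,\dots,2n+2\}$; for $i\in V_{2n}$ put $\overline{i}=2n+3-i$. Edges $E_{2n}=\{ij : i,j\in V_{2n},\ j\ne i,\overline{i}\}$ (with both orientations). Identify $H^*(BT^{n+1})=\mathbb{Z}[x_1,\dots,x_{n+1}]$ with $\deg x_i=2$, and put $x_0=0$. Define $f:V_{2n}\to H^2(BT^{n+1})$ by $f(j)=x_{j-1}-x_{n+1}$ for $1\le j\le n+2$ and $f(j)=x_n-x_{2n+2-j}$ for $n+3\le j\le 2n+2$, and $\alpha(ij)=f(j)-f(i)$ for $ij\in E_{2n}$. **Graph equivariant cohomology.** $H^*(\mathcal{GQ}_{2n})=\{h:V_{2n}\to H^*(BT^{n+1}) : h(i)-h(j)\equiv 0 \bmod \alpha(ij)\text{ for all } ij\in E_{2n}\}$, with pointwise ring operations. **Elements $M_v$, $\Delta_K$ of $H^*(\mathcal{GQ}_{2n})$.** For $v\in V_{2n}$: $M_v(v)=0$; $M_v(j)=f(v)-f(j)$ for $j\ne v,\overline{v}$; $M_v(\overline{v})=x_n-x_{n+1}-2f(\overline{v})$. A non-empty $K\subset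 V_{2n}$ has property $(\ast)$ if $\{i,\overline{i}\}\not\subset K$ for all $i\in V_{2n}$. For such $K$: $\Delta_K(j)=\prod_{k\notin K\cup\{\overline{j}\}}(f(k)-f(j))$ for $j\in K$, and $\Delta_K(j)=0$ for $j\notin K$. **The ring $\mathbb{Z}[\mathcal{GQ}_{2n}]$.** Let $\mathbb{Z}[\mathcal{M},\mathcal{D}]$ be the polynomial ring over $\mathbb{Z}$ on formal variables, denoted by the same symbols, $M_v$ ($v\in V_{2n}$), of degree $2$, and $\Delta_K$ ($K$ non-empty with property $(\ast)$), of degree $4n-2|K|+2$. For $J\subset V_{2n}$ put $G_J=M_v$ if $J=V_{2n}\setminus\{v\}$, and $G_J=\Delta_J$ if $J$ is non-empty with property $(\ast)$. Let $\mathcal{I}$ be the ideal generated by: (1) all products $G_{J_1}\cdots G_{J_r}$ ($r\ge1$, each $J_s$ of one of the two kinds just described) with $J_1\cap\cdots\cap J_r=\emptyset$; (2) $(M_i+M_{\overline{i}})-(M_j+M_{\overline{j}})$ for all distinct $i,j\in V_{2n}$; (3) $\prod_{i\in I}M_i-(\Delta_{(I\cup\{a\})^c}+\Delta_{(I\cup\{\overline{a}\})^c})$ for all $I\subset V_{2n}$ with property $(\ast)$ and $|I|=n$, where $\{a,\overline{a}\}$ is the unique such pair contained in $V_{2n}\setminus I$ and $(\cdot)^c$ is the complement in $V_{2n}$; (4) $\Delta_K\cdot M_i-\Delta_{K\setminus\{i\}}$ for all $K$ with property $(\ast)$ and $\{i\}\subsetneq K$. Then $\mathbb{Z}[\mathcal{GQ}_{2n}]:=\mathbb{Z}[\mathcal{M},\mathcal{D}]/\mathcal{I}$.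 The ring homomorphism $\widetilde\psi:\mathbb{Z}[\mathcal{M},\mathcal{D}]\to H^*(\mathcal{GQ}_{2n})$ sends each variable to the function with the same name; it vanishes on $\mathcal{I}$, and $\psi$ is the induced homomorphism on the quotient. *)

(* Defs.v *)
From HB Require Import structures.
From mathcomp Require Import all_boot all_order all_algebra.
From mathcomp Require Import boolp.
From mathcomp Require Import mpoly zify.

Set Implicit Arguments.
Unset Strict Implicit.
Unset Printing Implicit Defensive.

Import GRing.Theory.
Local Open Scope ring_scope.
Local Open Scope quotient_scope.

(* Vertices are 0-based: [i : vertex n] stands for the label i + 1 in
   {1, ..., 2n+2}. *)
Definition vertex (n : nat) := 'I_(2 * n + 2).

(* [rev_ord] is i |-> 2n+1 - i on indices, i.e. j |-> 2n+3 - j on labels. *)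
Definition bar (n : nat) (i : vertex n) : vertex n := rev_ord i.

Lemma bar_val n (i : vertex n) : (bar i).+1 = (2 * n + 3 - i.+1)%N.
Proof. by have := ltn_ord i; rewrite /=; lia. Qed.

Definition edge (n : nat) (i j : vertex n) : bool := (j != i) && (j != bar i).

Definition HBT (n : nat) := {mpoly int[n.+1]}.

(* 1-based variables, with x_0 = 0; only used for k <= n+1. *)
Definition x (n k : nat) : HBT n := if k is k'.+1 then 'X_(inord k') else 0.

Definition f (n : nat) (i : vertex n) : HBT n :=
  let j := i.+1 in
  if (j <= n + 2)%N then x n (j - 1) - x n (n + 1)
  else x n n - x n (2 * n + 2 - j).

Definition alpha (n : nat) (i j : vertex n) : HBT n := f j - f i.

Definition cochain (n : nat) := {ffun vertex n -> HBT n}.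

Definition gkm (n : nat) : {pred cochain n} := fun h =>
  `[< forall i j : vertex n, edge i j ->
        exists q : HBT n, h i - h j = q * alpha i j >].

Lemma gkm_subring n : subring_closed (@gkm n).
Proof.
split.
- apply/asboolP => i j _; exists 0; by rewrite !ffunE subrr mul0r.
- move=> g h /asboolP gP /asboolP hP; apply/asboolP => i j eij.
  have [q gq] := gP i j eij; have [r hr] := hP i j eij.
  exists (q - r); rewrite !ffunE mulrBl -gq -hr.
  by rewrite opprD addrACA -opprD.
- move=> g h /asboolP gP /asboolP hP; apply/asboolP => i j eij.
  have [q gq] := gP i j eij; have [r hr] := hP i j eij.
  exists (q * h i + g j * r); rewrite !ffunE mulrDl mulrAC -gq -mulrA -hr.
  by rewrite mulrBl mulrBr addrA subrK.
Qed.

HB.instance Definition _ n :=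
  GRing.isSubringClosed.Build (cochain n) (@gkm n) (@gkm_subring n).

Record HGQ (n : nat) := MkHGQ {
  HGQ_val :> cochain n;
  HGQ_valP : HGQ_val \in @gkm n
}.

HB.instance Definition _ n := [isSub for @HGQ_val n].
HB.instance Definition _ n := [Choice of HGQ n by <:].
HB.instance Definition _ n :=
  GRing.SubChoice_isSubPzRing.Build (cochain n) (@gkm n) (HGQ n) (@gkm_subring n).

Definition Mfun (n : nat) (v : vertex n) : cochain n :=
  [ffun j => if j == v then 0
             else if j == bar v then x n n - x n (n + 1) - f (bar v) *+ 2
             else f v - f j].

(* Non-emptiness is part of the property. *)
Definition star (n : nat) (K : {set vertex n}) : bool :=
  (K != set0) && [forall i, ~~ ([set i; bar i] \subset K)].

Definition Dfun (n : nat) (K : {set vertex n}) : cochain n :=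
  [ffun j => if j \in K then \prod_(k | k \notin K :|: [set bar j]) (f k - f j)
             else 0].

Definition gen (n : nat) := (vertex n + {K : {set vertex n} | star K})%type.

Definition ZMD (n : nat) := {mpoly int[#|{: gen n}|]}.

Definition var (n : nat) (g : gen n) : ZMD n := 'X_(enum_rank g).

Definition Mvar (n : nat) (v : vertex n) : ZMD n := var (inl v).

(* The value 0 when ~~ star K is junk. *)
Definition Dvar (n : nat) (K : {set vertex n}) : ZMD n :=
  if insub K is Some u then var (inr u) else 0.

(* The set J such that the variable is G_J. *)
Definition gen_set (n : nat) (g : gen n) : {set vertex n} :=
  match g with inl v => ~: [set v] | inr u => val u end.

Inductive relator (n : nat) : ZMD n -> Prop :=
| Rel1 (s : seq (gen n)) :
    s != [::] -> \bigcap_(g <- s) gen_set g = set0 ->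
    relator (\prod_(g <- s) var g)
| Rel2 (i j : vertex n) :
    i != j ->
    relator ((Mvar i + Mvar (bar i)) - (Mvar j + Mvar (bar j)))
| Rel3 (I : {set vertex n}) (a : vertex n) :
    star I -> #|I| = n ->
    [set a; bar a] \subset ~: I ->
    relator (\prod_(i in I) Mvar i
             - (Dvar (~: (I :|: [set a])) + Dvar (~: (I :|: [set bar a]))))
| Rel4 (K : {set vertex n}) (i : vertex n) :
    star K -> [set i] \proper K ->
    relator (Dvar K * Mvar i - Dvar (K :\ i)).

Definition ideal_span (R : comNzRingType) (S : R -> Prop) : {pred R} := fun p =>
  `[< exists s : seq (R * R),
        (forall t, t \in s -> S t.2) /\ p = \sum_(t <- s) t.1 * t.2 >].

Definition IGQ (n : nat) : {pred ZMD n} := ideal_span (@relator n).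

Lemma ideal_span0 (R : comNzRingType) (S : R -> Prop) : 0 \in ideal_span S.
Proof. by apply/asboolP; exists [::]; split=> //; rewrite big_nil. Qed.

Lemma ideal_spanD (R : comNzRingType) (S : R -> Prop) (a : R) :
  {in ideal_span S &, forall u v, a * u + v \in ideal_span S}.
Proof.
move=> _ _ /asboolP[s [sS ->]] /asboolP[t [tS ->]]; apply/asboolP.
exists ([seq (a * p.1, p.2) | p <- s] ++ t); split.
  move=> p; rewrite mem_cat => /orP[/mapP[q qs ->]|/tS //]; exact: (sS q).
rewrite big_cat big_map mulr_sumr /=; congr (_ + _).
by apply: eq_bigr => p _; rewrite mulrA.
Qed.

Lemma relator_eval0 n (p : ZMD n) : relator p -> p.@[fun _ => 0] = 0.
Proof.
have M0 v : (Mvar v).@[fun _ => 0 : int] = 0 by rewrite /Mvar /var mevalXU.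
have D0 K : (Dvar K).@[fun _ => 0 : int] = 0 :> int.
  by rewrite /Dvar; case: insubP => [u _ _|_]; rewrite ?meval0 // /var mevalXU.
case=> [[|g s] // _ _|i j _|I a sI _ _|K i _ _].
- by rewrite big_cons mevalM /var mevalXU mul0r.
- by rewrite mevalB !mevalD !M0 subrr.
- have /set0Pn[i iI] : I != set0 by case/andP: sI.
  by rewrite (bigD1 i) //= mevalB mevalD mevalM !D0 M0 mul0r subr0.
- by rewrite mevalB mevalM !D0 mul0r subr0.
Qed.

Lemma IGQ_idealr n : idealr_closed (@IGQ n).
Proof.
split; [exact: ideal_span0| |exact: ideal_spanD].
apply/asboolPn => -[s [sS /(congr1 (meval (fun _ => 0)))]].
rewrite meval1 raddf_sum big_seq big1 /= => [/eqP|p /sS /relator_eval0 p0].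
  by rewrite oner_eq0.
by rewrite mevalM p0 mulr0.
Qed.

HB.instance Definition _ n :=
  isIdealr.Build (ZMD n) (@IGQ n) (@IGQ_idealr n).

Definition ZGQ (n : nat) := {ideal_quot (@IGQ n)}.

Definition class (n : nat) (p : ZMD n) : ZGQ n := \pi_({ideal_quot (@IGQ n)}) p.

(* Main.v *)
(** Put [c := f i + f (bar i)], which does not depend on [i].  Then
    [M_v = f v - X], where [X] is the function [j |-> f j], so that modulo the
    linear relations the subring generated by the [M_v] is [HBT[X]].  Ordering
    the vertices, the Schubert-like classes [\prod_(k < v) M_k] (for the first
    n+1 vertices [v]) and [Delta_{w >= v}] (for the others) vanish below [v],
    and their value at [v] is the product of the weights of the edges from [v]
    to smaller vertices.  These weights are pairwise coprime, so triangularity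
    makes the classes an [HBT]-basis of the graph cohomology.

    It remains to see that the same classes span the quotient ring over [HBT].
    Their span is stable under the [M_i].  Call a set containing exactly one
    element of each pair [{i, bar i}] Lagrangian.  Relation (4) reduces any
    [Delta_K] to a Lagrangian one, and relation (3) says that exchanging
    [i \in K] for [bar i] in a Lagrangian [K] changes [Delta_K] to
    [- Delta_K'] up to a polynomial in the [M_i].  Exchanging one element at a
    time puts all [Delta_K] in the span, and brings a product
    [Delta_K * Delta_L] to [Delta_K * Delta_(~: K)], which is 0. *)
Require Import Defs.
From HB Require Import structures.
From mathcomp Require Import all_boot all_order all_algebra.
From mathcomp Require Import boolp ring.
From mathcomp Require Import mpoly zify.

Import GRing.Theory.
Local Open Scope ring_scope.

Set Implicit Arguments.
Unset Strict Implicit.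

(** * Isotropic and Lagrangian sets of vertices *)

Section Vertices.
Variable n : nat.
Implicit Types (i j k v w : vertex n) (K L : {set vertex n}).

Lemma barK : involutive (@bar n). Proof. exact: rev_ordK. Qed.

Lemma bar_inj : injective (@bar n). Proof. exact: inv_inj barK. Qed.

Lemma bar_neq i : bar i != i.
Proof. by apply/eqP => /(congr1 val) /=; have := ltn_ord i; lia. Qed.

Lemma bar_eqC i j : (bar i == j) = (i == bar j).
Proof. exact: inv_eq barK _ _. Qed.

Definition lagrangian K := [forall i, (bar i \in K) == (i \notin K)].

Lemma lagrangianP K :
  reflect (forall i, (bar i \in K) = (i \notin K)) (lagrangian K).
Proof. by apply: (iffP forallP) => h i; apply/eqP; rewrite ?h. Qed.

Lemma starP K :
  reflect (K != set0 /\ forall i, i \in K -> bar i \notin K) (star K).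
Proof.
apply: (iffP andP) => -[K0].
  move=> /forallP h; split=> // i iK; have := h i.
  by rewrite subUset !sub1set iK.
move=> h; split=> //; apply/forallP => i; rewrite subUset !sub1set.
by apply/negP => /andP[/h/negP].
Qed.

Lemma lagrangianC K : lagrangian K -> lagrangian (~: K).
Proof. by move=> /lagrangianP h; apply/lagrangianP => i; rewrite !inE h. Qed.

(** [K] and its image under [bar] are disjoint of size [n.+1] each, so together they fill all
    [2 * n + 2] vertices. *)
Lemma isotropic_card_lagrangian K :
  (forall i, i \in K -> bar i \notin K) -> #|K| = n.+1 -> lagrangian K.
Proof.
move=> h cK; apply/lagrangianP => i.
have dis : [disjoint K & @bar n @: K].
  rewrite disjoints_subset; apply/subsetP => j jK; rewrite inE.
  by apply/imsetP => -[k kK jE]; have := h k kK; rewrite -jE jK.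
have := leq_card_setU K (@bar n @: K); rewrite dis => -[_ /eqP].
rewrite card_imset ?cK; last exact: bar_inj.
move=> cU; have : K :|: @bar n @: K = setT.
  by apply/eqP; rewrite eqEcard subsetT cardsT card_ord cU; lia.
move=> /setP /(_ i); rewrite !inE; case: (boolP (i \in K)) => [/h/negbTE->//|_].
by case/imsetP => j jK ->; rewrite barK jK.
Qed.

Lemma lagrangian_card K : lagrangian K -> #|K| = n.+1.
Proof.
move=> /lagrangianP h; have KC : ~: K = @bar n @: K.
  apply/setP => i; rewrite inE -h; apply/idP/imsetP => [iK|[j jK ->]].
    by exists (bar i) => //; rewrite barK.
  by rewrite barK.
have := cardsC K; rewrite KC card_imset ?card_ord; last exact: bar_inj.
by move: #|K| => c e; lia.
Qed.

Lemma lagrangian_star K : lagrangian K -> star K.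
Proof.
move=> lK; apply/starP; split=> [|i]; last by rewrite (lagrangianP _ lK) negbK.
by rewrite -card_gt0 lagrangian_card.
Qed.

Definition swap K i := bar i |: K :\ i.

Lemma in_swap K i j : lagrangian K -> i \in K ->
  (j \in swap K i) = (j \in K) (+) ((j == i) || (j == bar i)).
Proof.
move=> /lagrangianP lK iK; rewrite !inE.
have [->|ji] := eqVneq j i; first by rewrite iK eq_sym (negbTE (bar_neq i)).
by have [->|jb] := eqVneq j (bar i); rewrite ?lK ?iK // addbF.
Qed.

Lemma swap_lagrangian K i : lagrangian K -> i \in K -> lagrangian (swap K i).
Proof.
move=> lK iK; apply/lagrangianP => j; rewrite !in_swap // (lagrangianP _ lK).
by rewrite bar_eqC (inj_eq bar_inj) orbC addNb.
Qed.

(** Exchanging an element of [K :\: K0] for its [bar] lands in [K0], so [#|K :\: K0|] drops; once it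
    is 0, equal cardinalities force [K = K0]. *)
Lemma lagrangian_swap_ind (P : {set vertex n} -> Prop) K0 :
  lagrangian K0 -> P K0 ->
  (forall K i, lagrangian K -> i \in K -> P (swap K i) -> P K) ->
  forall K, lagrangian K -> P K.
Proof.
move=> l0 P0 Ps K; have [m] := ubnP #|K :\: K0|; elim: m K => // m IH K.
move=> cm lK; have [K0E|[i]] := set_0Vmem (K :\: K0).
  suff -> : K = K0 by [].
  apply/eqP; rewrite eqEcard !lagrangian_card // leqnn andbT.
  by rewrite -setD_eq0 K0E.
rewrite inE => /andP[iK0 iK]; apply: (Ps K i lK iK); apply: IH; last first.
  exact: swap_lagrangian.
rewrite ltnS in cm; apply: leq_trans cm.
apply: (@leq_ltn_trans #|(K :\: K0) :\ i|).
  apply: subset_leq_card; apply/subsetP => j; rewrite /swap !inE.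
  case/andP => jK0 /orP[/eqP jE|/andP[-> ->]]; last by rewrite jK0.
  by move: jK0; rewrite jE (lagrangianP _ l0) iK0.
by rewrite (cardsD1 i (K :\: K0)) inE iK0 iK.
Qed.

(** From each pair that [K] misses entirely, the smaller element is added. *)
Lemma star_sub_lagrangian K : star K -> exists2 L, lagrangian L & K \subset L.
Proof.
move=> /starP[_ h].
exists [set i | (i \in K) || (bar i \notin K) && (i < bar i)%N]; last first.
  by apply/subsetP => i iK; rewrite inE iK.
apply/lagrangianP => i; rewrite !inE barK.
have := h i; have := h (bar i); rewrite barK.
case: (i \in K); case: (bar i \in K) => //= h1 h2.
- by have := h1 isT.
- by have := ltn_ord i; lia.
Qed.

Lemma starD1 K i : star K -> [set i] \proper K -> star (K :\ i).
Proof.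
move=> /starP[_ h] iK; apply/starP; split.
  by rewrite setD_eq0; case/andP: iK.
by move=> j; rewrite !inE => /andP[_ /h /negbTE->]; rewrite andbF.
Qed.

End Vertices.

(** * The coefficient ring, generated by the values of [f] *)

Section Scalars.

Lemma mpoly_int_ind m (P : {mpoly int[m]} -> Prop) :
  P 1 -> (forall p q, P p -> P q -> P (p - q)) ->
  (forall p q, P p -> P q -> P (p * q)) -> (forall i, P 'X_i) -> forall p, P p.
Proof.
move=> P1 PB PM PX p.
have P0 : P 0 by rewrite -(subrr 1); apply: PB.
have PD q r : P q -> P r -> P (q + r).
  by move=> Pq Pr; rewrite -[r]opprK -[- r]sub0r; apply: (PB) => //; apply: PB.
rewrite (mpolyE p); apply: big_ind => // k _.
rewrite -mul_mpolyC mpolyXE_id; apply: (PM); last first.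
  apply: big_ind => // i _; elim: (k i) => [|e IH]; first by rewrite expr0.
  by rewrite exprS; apply: PM.
have PN e : P e%:R by elim: e => // e IH; rewrite -natr1; apply: PD.
have -> : (p@_k)%:MP = (p@_k)%:~R :> {mpoly int[m]}.
  by rewrite -[in LHS](intz p@_k) rmorph_int.
case: (p@_k) => e; first exact: PN.
by rewrite NegzE mulrNz -sub0r; apply: PB => //; exact: PN.
Qed.

Variable n : nat.
Implicit Types i j k v w : vertex n.

Lemma vertex_size : (2 * n + 1).+1 = (2 * n + 2)%N. Proof. by lia. Qed.

(** A total function on naturals; an [e] out of range gives vertex 0. The cast supplies the
    successor form of the bound that [inord] expects. *)
Definition vtx e : vertex n := cast_ord vertex_size (inord e).

Lemma vtxK e : (e < 2 * n + 2)%N -> vtx e = e :> nat.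
Proof. by move=> en; rewrite /= inordK // vertex_size. Qed.

Lemma vtx_val i : vtx i = i.
Proof. by apply: ord_inj; rewrite vtxK. Qed.

Lemma xK e : (e <= n.+1)%N -> x n e = f (vtx e) - f (vtx 0).
Proof.
move=> en; rewrite /f !vtxK; [|lia|lia].
by rewrite !ifT; [|lia|lia]; rewrite !subn1 /= sub0r opprK subrK.
Qed.

Lemma f_bar i : f i + f (bar i) = x n n - x n (n + 1).
Proof.
wlog : i / (i <= n)%N => [hw|le_in].
  have [/hw//|lt_ni] := leqP i n.
  by rewrite addrC -[in X in _ + X](barK i) hw //=; lia.
rewrite /f ifT ?subn1 /=; last by lia.
have lt_i := ltn_ord i; case: ifP => i_n.
  have -> : i = n :> nat by lia.
  by rewrite (_ : 2 * n + 2 - n.+1 = n.+1)%N ?addn1 ?subrr ?addr0 //; lia.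
by rewrite addrC (_ : 2 * n + 2 - _ = i)%N; [rewrite addrA subrK|lia].
Qed.

Lemma HBT_ind (P : HBT n -> Prop) :
  P 1 -> (forall p q, P p -> P q -> P (p - q)) ->
  (forall p q, P p -> P q -> P (p * q)) -> (forall i, P (f i)) -> forall p, P p.
Proof.
move=> P1 PB PM Pf; apply: mpoly_int_ind => // i.
have -> : 'X_i = x n i.+1 by rewrite /= inord_val.
by rewrite xK //; apply: PB.
Qed.

(** Universal property of [HBT n]: the values of [f] generate it, subject only to [f i + f (bar i)]
    being constant and to [f] vanishing at [vtx n n.+1]. The second condition is why [g (vtx n.+1)]
    is subtracted. The map sends the variable of index [u] to [g (vtx u.+1) - g (vtx 0)]. *)
Lemma HBT_hom (R : comNzRingType) (g : vertex n -> R) c :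
  (forall i, g i + g (bar i) = c) ->
  exists phi : {rmorphism HBT n -> R}, forall i, phi (f i) = g i - g (vtx n.+1).
Proof.
move=> gc.
pose phi : {rmorphism HBT n -> R} :=
  mmap (intmul 1) (fun u : 'I_n.+1 => g (vtx u.+1) - g (vtx 0)).
exists phi => i.
have phix e : (e <= n.+1)%N -> phi (x n e) = g (vtx e) - g (vtx 0).
  case: e => [_|e en]; first by rewrite rmorph0 subrr.
  by rewrite /= mmapX mmap1U inordK.
have := ltn_ord i; rewrite /f; case: ifP => i_n lt_i.
  rewrite rmorphB !phix; try lia.
  by rewrite opprB addrA subrK subn1 vtx_val addn1.
rewrite rmorphB !phix; try lia.
(* In this branch the image is [g (vtx n) - g (bar i)]; constancy of the sums on the pairs of [i]
   and of [vtx n] turns it into [g i - g (vtx n.+1)]. *)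
have -> : vtx (2 * n + 2 - i.+1) = bar i.
  by apply: ord_inj; rewrite vtxK //=; lia.
have <- : bar (vtx n) = vtx n.+1.
  by apply: ord_inj; rewrite /= !inordK; lia.
rewrite opprB addrA subrK.
by apply/eqP; rewrite subr_eq addrAC gc -(gc (vtx n)) addrK.
Qed.

Definition upper e : {set vertex n} := [set w : vertex n | (e <= w)%N].

Lemma in_upper e v : (v \in upper e) = (e <= v)%N.
Proof. by rewrite inE. Qed.

Lemma upper_star e : (n < e)%N -> (e < 2 * n + 2)%N -> star (upper e).
Proof.
move=> n_e e_n; apply/starP; split=> [|i].
  by apply/set0Pn; exists (vtx e); rewrite in_upper vtxK.
by rewrite !in_upper /=; have := ltn_ord i; lia.
Qed.

Lemma upper_lagrangian : lagrangian (upper n.+1).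
Proof.
by apply/lagrangianP => i; rewrite !in_upper /=; have := ltn_ord i; lia.
Qed.

Lemma upperD1 v : upper v :\ v = upper v.+1.
Proof.
by apply/setP => w; rewrite !inE -(inj_eq (@ord_inj _)) ltn_neqAle eq_sym.
Qed.

End Scalars.

(** * Coprimality of the edge weights at a vertex *)

Section Divisibility.
Variable n : nat.
Implicit Types i j k v w : vertex n.

Lemma f_vtx_succ : f (vtx n n.+1) = 0.
Proof.
rewrite /f vtxK; last by lia.
by rewrite ifT ?subn1 ?addn1 ?subrr //; lia.
Qed.

(** An integer point separates the values: [g] is 1 at [k], -1 at [bar k] and 0 elsewhere, so
    [f k - f v] is sent to 1 or 2. *)
Lemma f_inj : injective (@f n).
Proof.
move=> k v; apply: contra_eq => kv; pose g i := (i == k)%:Z - (i == bar k)%:Z.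
have [|phi phif] := @HBT_hom n _ g 0.
  by move=> i; rewrite /g (inj_eq (@bar_inj n)) bar_eqC; ring.
rewrite -subr_eq0; apply: contraTneq isT => /(congr1 phi).
rewrite rmorph0 rmorphB !phif /g !eqxx [v == k]eq_sym (negbTE kv).
rewrite eq_sym (negbTE (bar_neq k)).
by case: (v == bar k); case: (_ == k); case: (_ == bar k).
Qed.

(** The map substitutes [f v] for [f k], and shifts [f (bar k)] oppositely to keep the sum on the
    pair. It is the identity modulo [f k - f v], so its kernel is the ideal of that weight, which is
    prime because [HBT n] is a domain. *)
Lemma f_sub_prime k v : k != v -> k != bar v ->
  exists phi : {rmorphism HBT n -> HBT n},
    phi (f k - f v) = 0 /\ forall p, exists q, p - phi p = q * (f k - f v).
Proof.
move=> kv kbv; set L := f k - f v.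
pose g i := f i + L * ((i == bar k)%:R - (i == k)%:R).
have [|phi phif] := @HBT_hom n _ g (x n n - x n (n + 1)).
  move=> i; rewrite /g (inj_eq (@bar_inj n)) bar_eqC addrACA f_bar; ring.
exists phi; split.
  rewrite rmorphB !phif opprB addrA subrK /g eqxx [v == k]eq_sym (negbTE kv).
  have vbk : v != bar k by rewrite -bar_eqC eq_sym.
  rewrite (negbTE vbk).
  rewrite [k == _]eq_sym (negbTE (bar_neq k)).
  by rewrite subrr mulr0 addr0 sub0r mulrN1 /L opprB addrCA subrr addr0 subrr.
elim/HBT_ind => [|p q [p' hp] [q' hq]|p q [p' hp] [q' hq]|i].
- by exists 0; rewrite rmorph1 subrr mul0r.
- by exists (p' - q'); rewrite mulrBl -hp -hq rmorphB; ring.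
- exists (p' * q + phi p * q').
  by rewrite mulrDl [p' * q * L]mulrAC -hp -mulrA -hq rmorphM; ring.
- exists (((vtx n n.+1 == bar k)%:R - (vtx n n.+1 == k)%:R)
          - ((i == bar k)%:R - (i == k)%:R)).
  by rewrite phif /g f_vtx_succ; ring.
Qed.

(** Applying the substitution of [f_sub_prime] to the equation kills the right side, so one of the
    two factors on the left is killed. If it is [p], the claim follows; otherwise [f w - f v] would
    be a multiple of [f k - f v], which an integer point excludes. *)
Lemma f_sub_coprime v k w p q :
  k != v -> k != bar v -> w != v -> w != k ->
  (f w - f v) * p = q * (f k - f v) -> exists r, p = r * (f k - f v).
Proof.
move=> kv kbv wv wk e; have [phi [phi0 phiP]] := f_sub_prime kv kbv.
have [r hr] := phiP p; exists r; rewrite -hr.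
suff -> : phi p = 0 by rewrite subr0.
have /eqP := congr1 phi e; rewrite !rmorphM phi0 mulr0 mulf_eq0.
case/orP => /eqP // phiw; exfalso; have [s] := phiP (f w - f v).
rewrite phiw subr0.
(* At this point [v] and [k] both have value -1, so [f k - f v] becomes 0, whereas [w] has a
   nonnegative value, so [f w - f v] becomes positive. *)
pose g i := (i == bar v)%:Z + (i == bar k)%:Z - (i == v)%:Z - (i == k)%:Z.
have [|ev evf] := @HBT_hom n _ g 0.
  by move=> i; rewrite /g !(inj_eq (@bar_inj n)) !bar_eqC; ring.
have evB i j : ev (f i - f j) = g i - g j.
  by rewrite rmorphB !evf; ring.
move/(congr1 ev); rewrite rmorphM !evB.
have vbk : v != bar k by rewrite -bar_eqC eq_sym.
have vbv : v != bar v by rewrite eq_sym bar_neq.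
have kbk : k != bar k by rewrite eq_sym bar_neq.
have vk : v != k by rewrite eq_sym.
rewrite /g !eqxx (negbTE kv) (negbTE kbv) (negbTE wv) (negbTE wk).
rewrite (negbTE vbk) (negbTE vbv) (negbTE kbk) (negbTE vk).
by case: (w == _); case: (w == _); rewrite subrr mulr0.
Qed.

(** After dividing by one weight, coprimality keeps the quotient divisible by each of the others. *)
Lemma prod_f_sub_dvd v (A : {set vertex n}) (p : HBT n) :
  (forall k, k \in A -> k != v /\ k != bar v) ->
  (forall k, k \in A -> exists q, p = q * (f k - f v)) ->
  exists q, p = q * \prod_(k in A) (f k - f v).
Proof.
have [m] := ubnP #|A|; elim: m => // m IH in A p *; rewrite ltnS => cA Av Ap.
have [A0|[w wA]] := set_0Vmem A; first by exists p; rewrite A0 big_set0 mulr1.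
have [q pq] := Ap w wA; have [wv wbv] := Av w wA.
have [||k|r qr] := IH (A :\ w) q.
- by rewrite [#|_|](cardsD1 w) wA in cA.
- by move=> k /setD1P[_ /Av].
- move=> /setD1P[kw kA]; have [kv kbv] := Av k kA; have [r pr] := Ap k kA.
  by apply: (@f_sub_coprime v k w q r) => //; rewrite 1?eq_sym // mulrC -pq.
by exists r; rewrite (big_setD1 w) //= pq qr; ring.
Qed.

End Divisibility.

(** * Evaluation at a vertex, the edge congruences, and the vanishing of the relators *)

Section Evaluation.
Variable n : nat.
Implicit Types (i j k v w : vertex n) (K : {set vertex n}).

Lemma f_barE i : f (bar i) = x n n - x n (n + 1) - f i.
Proof. by rewrite -(f_bar i) addrAC subrr add0r. Qed.

(** The separate value at [bar v] is no exception, since [x n n - x n (n + 1)] is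
    [f v + f (bar v)]. *)
Lemma MfunE v j : Mfun v j = f v - f j.
Proof.
rewrite ffunE; case: eqVneq => [->|_]; first by rewrite subrr.
case: eqVneq => [->|//].
by rewrite f_barE; ring.
Qed.

Lemma DfunE K j :
  Dfun K j = if j \in K then \prod_(k in ~: K :\ bar j) (f k - f j) else 0.
Proof.
rewrite ffunE; case: ifP => // _; apply: eq_bigl => k.
by rewrite !inE negb_or andbC.
Qed.

Definition gen_fun (g : gen n) : cochain n :=
  match g with inl v => Mfun v | inr u => Dfun (val u) end.

Lemma setDAC (T : finType) (A B C : {set T}) : A :\: B :\: C = A :\: C :\: B.
Proof. by rewrite !setDDl setUC. Qed.

Lemma gen_fun_notin g j : j \notin gen_set g -> gen_fun g j = 0.
Proof.
case: g => [v|u] /=; first by rewrite !inE negbK => /eqP->; rewrite MfunE subrr.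
by rewrite DfunE => /negbTE->.
Qed.

(* Hidden behind Qed because unfolding [ev] makes unification intractable. *)
Lemma ev_subproof : {ev : vertex n -> {rmorphism ZMD n -> HBT n} |
  forall j g, ev j (var g) = gen_fun g j}.
Proof.
exists (fun j => mmap (intmul 1) (fun u => gen_fun (enum_val u) j)) => j g.
by rewrite /var /= mmapX mmap1U enum_rankK.
Qed.

Definition ev := sval ev_subproof.

Lemma ev_var j g : ev j (var g) = gen_fun g j.
Proof. exact: (svalP ev_subproof). Qed.

Lemma ev_Mvar j v : ev j (Mvar v) = f v - f j.
Proof. by rewrite ev_var MfunE. Qed.

Lemma ev_Dvar j K : star K -> ev j (Dvar K) = Dfun K j.
Proof. by move=> sK; rewrite /Dvar insubT ev_var. Qed.

(** Relation (3) at the vertex [j]. For [j] outside [K] and the swapped set every term vanishes; at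
    [i] and [bar i] only one term on the right survives. Otherwise all three products share the
    factors over [Z], and the remaining ones satisfy [f (bar i) - f j + (f i - f j) = f (bar j) - f
    j]. *)
Lemma Dfun_swap K i j : lagrangian K -> i \in K ->
  \prod_(k in ~: K :\ bar i) (f k - f j) = Dfun K j + Dfun (swap K i) j.
Proof.
move=> lK iK; have /lagrangianP lK' := lK.
rewrite !DfunE in_swap //.
have swE : ~: swap K i = i |: (~: K :\ bar i).
  apply/setP => k; rewrite in_setC in_swap // !inE.
  have [->|ki] := eqVneq k i; first by rewrite iK.
  have [->|kb] := eqVneq k (bar i); first by rewrite lK' iK.
  by rewrite addbF.
have [jK|jK] := boolP (j \in K); last first.
  have [->|jb] := eqVneq j (bar i).
    rewrite orbT /= add0r barK swE setU1K //.
    by rewrite !inE iK andbF.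
  have [jE|_] := eqVneq j i; first by rewrite jE iK in jK.
  by rewrite addr0 (big_setD1 j) ?inE ?jb //= subrr mul0r.
have [->|ji] := eqVneq j i; first by rewrite addr0.
have jb : j != bar i by apply: contraTneq jK => ->; rewrite lK' iK.
rewrite (negbTE jb) /= swE.
have bjK : bar j \notin K by rewrite lK' jK.
pose Z := ~: K :\ bar i :\ bar j.
have -> : ~: K :\ bar i = bar j |: Z.
  by rewrite setD1K // !inE bjK (inj_eq (@bar_inj n)) ji.
have -> : ~: K :\ bar j = bar i |: Z.
  rewrite /Z setDAC setD1K // !inE lK' iK.
  by rewrite (inj_eq (@bar_inj n)) eq_sym ji.
have -> : (i |: (bar j |: Z)) :\ bar j = i |: Z.
  rewrite setUCA setU1K // !inE eqxx orbF.
  by rewrite bar_eqC.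
rewrite !big_setU1 ?inE ?eqxx ?andbF //=; last by rewrite iK !andbF.
by rewrite !f_barE; ring.
Qed.

Lemma prod_f_sub_cong (A : {set vertex n}) i j :
  exists q, \prod_(k in A) (f k - f i) - \prod_(k in A) (f k - f j)
            = q * (f j - f i).
Proof.
elim/big_ind2: _ => [|a b c d [q hq] [r hr]|k _]; last by exists 1; ring.
  by exists 0; ring.
exists (q * c + b * r); rewrite mulrDl -!mulrA -hr [c * _]mulrC mulrA -hq; ring.
Qed.

Lemma Dfun_gkm K i j : star K -> edge i j ->
  exists q, Dfun K i - Dfun K j = q * alpha i j.
Proof.
move=> /starP[_ sK] /andP[ji jbi]; rewrite !DfunE /alpha.
have [iK|iK] := boolP (i \in K); have [jK|jK] := boolP (j \in K).
- have [q hq] := prod_f_sub_cong (~: K :\ bar i :\ bar j) i j.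
  (* The two products differ by one factor each, and these agree:
     [f (bar j) - f i = f (bar i) - f j] by constancy of the sums. The rest is congruent factor by
     factor. *)
  exists ((f (bar i) - f j) * q).
  rewrite (big_setD1 (bar j)) ?inE ?(inj_eq (@bar_inj n)) ?ji ?sK //=.
  rewrite [X in _ - X](big_setD1 (bar i)) /=; last first.
    rewrite !inE (inj_eq (@bar_inj n)).
    by rewrite eq_sym ji sK.
  rewrite [_ :\ bar j :\ bar i]setDAC -mulrA -hq.
  have -> : f (bar j) - f i = f (bar i) - f j; last by ring.
  by rewrite !f_barE; ring.
- exists (\prod_(k in ~: K :\ bar i :\ j) (f k - f i)).
  by rewrite (big_setD1 j) ?inE ?jbi //= subr0 mulrC.
- have ibj : i != bar j by rewrite -bar_eqC eq_sym.
  exists (\prod_(k in ~: K :\ bar j :\ i) (f k - f j)).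
  by rewrite [X in _ - X](big_setD1 i) ?inE ?ibj //=; ring.
- by exists 0; rewrite subrr mul0r.
Qed.

Lemma rmorph_cong m (S : comNzRingType)
    (phi psi : {rmorphism {mpoly int[m]} -> S}) a :
  (forall u, exists q, phi 'X_u - psi 'X_u = q * a) ->
  forall p, exists q, phi p - psi p = q * a.
Proof.
move=> hX; elim/mpoly_int_ind => [|p q [c hc] [d hd]|p q [c hc] [d hd]|//].
- by exists 0; rewrite !rmorph1 subrr mul0r.
- by exists (c - d); rewrite mulrBl -hc -hd !rmorphB; ring.
- exists (c * phi q + psi p * d).
  by rewrite mulrDl [_ * _ * a]mulrAC -hc -mulrA -hd !rmorphM; ring.
Qed.

Lemma ev_gkm p i j : edge i j -> exists q, ev i p - ev j p = q * alpha i j.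
Proof.
move=> ij; apply: rmorph_cong => u.
have -> : 'X_u = var (enum_val u) :> ZMD n by rewrite /var enum_valK.
rewrite !ev_var; case: (enum_val u) => [v|[K sK]] /=.
  by exists 1; rewrite !MfunE /alpha; ring.
exact: Dfun_gkm.
Qed.

(** Rewrites the data of relation (3) as a swap: adding [a] to [I] gives an isotropic set of size
    [n.+1], hence a Lagrangian one, and [K] is its complement. *)
Lemma Rel3_lagrangian (I : {set vertex n}) a :
  star I -> #|I| = n -> [set a; bar a] \subset ~: I ->
  let K := ~: (I :|: [set a]) in
  [/\ lagrangian K, bar a \in K, I = ~: K :\ a
     & ~: (I :|: [set bar a]) = swap K (bar a)].
Proof.
move=> /starP[_ sI] cI; rewrite subUset !sub1set !inE => /andP[aI baI] K.
have lK : lagrangian K.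
  apply/lagrangianC/isotropic_card_lagrangian; last first.
    by rewrite setUC cardsU1 aI cI.
  move=> i; rewrite !inE => /orP[iI|/eqP->]; last first.
    by rewrite negb_or baI bar_neq.
  rewrite negb_or sI //=; apply: contraNneq baI => <-; by rewrite barK.
have baK : bar a \in K by rewrite !inE negb_or baI bar_neq.
split=> //; apply/setP => k.
  rewrite !inE negbK; have [->|_] := eqVneq k a; first by rewrite (negbTE aI).
  by rewrite orbF.
rewrite in_swap // barK !inE.
have [->|_] := eqVneq k a.
  by rewrite (negbTE aI) eq_sym (negbTE (bar_neq a)).
have [->|_] := eqVneq k (bar a); first by rewrite (negbTE baI).
by rewrite !orbF addbF.
Qed.

Lemma Dfun_M K i j : star K -> [set i] \proper K ->
  Dfun K j * (f i - f j) = Dfun (K :\ i) j.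
Proof.
move=> /starP[_ sK] /andP[]; rewrite sub1set => iK _; rewrite !DfunE !inE.
have [->|ji] /= := eqVneq j i; first by rewrite subrr mulr0.
case: ifP => jK; last by rewrite mul0r.
have ibj : i != bar j by apply: contraTneq iK => ->; apply: sK.
rewrite [RHS](big_setD1 i) ?inE ?ibj ?eqxx //= mulrC; congr (_ * _).
apply: eq_bigl => k; rewrite !inE.
by have [->|_] := eqVneq k i; rewrite ?iK ?andbF.
Qed.

Lemma ev_relator (hn : (0 < n)%N) p j : relator p -> ev j p = 0.
Proof.
case=> {p} [s _ s0|i k _|I a sI cI aI|K i sK iK].
(* A nonzero value at [j] would put [j] into the set of every generator, hence into their empty
   intersection. *)
- rewrite rmorph_prod; apply/eqP; apply: contraFT (in_set0 j).
  rewrite prodf_seq_neq0 -s0 => /allP h; rewrite big_seq.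
  elim/big_ind: _ => [|A B jA jB|g gs]; rewrite ?inE ?jA //.
  by have := h g gs; rewrite ev_var /=; apply: contraR => /gen_fun_notin->.
- by rewrite rmorphB !rmorphD !ev_Mvar !f_barE; ring.
- have [] := Rel3_lagrangian sI cI aI; set K := ~: (_ :|: [set a]).
  move=> lK aK IE ->; rewrite IE rmorphB rmorphD rmorph_prod.
  rewrite !ev_Dvar ?lagrangian_star ?swap_lagrangian // -Dfun_swap // barK.
  by apply/eqP; rewrite subr_eq0; apply/eqP/eq_bigr => k _; rewrite ev_Mvar.
- rewrite rmorphB rmorphM ev_Mvar !ev_Dvar ?starD1 //.
  by rewrite Dfun_M // subrr.
Qed.

End Evaluation.

(** * Spanning by the Schubert-like classes in any ring where the relations hold *)

Section Spanning.
Variables (n : nat) (Q : comNzRingType).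
Variables (m : vertex n -> Q) (d : {set vertex n} -> Q).
Implicit Types (i j k v w : vertex n) (K L : {set vertex n}) (p q : Q).

Definition schubert e : Q :=
  if (e <= n)%N then \prod_(k : vertex n | (k < e)%N) m k else d (upper n e).

Variable phi : {rmorphism HBT n -> Q}.
Hypothesis n_gt0 : (0 < n)%N.
Hypothesis phi_f : forall i j, phi (f i - f j) = m i - m j.
Hypothesis dM : forall K i,
  star K -> [set i] \proper K -> d K * m i = d (K :\ i).
Hypothesis d1M : forall i, d [set i] * m i = 0.
Hypothesis d_swap : forall K i, lagrangian K -> i \in K ->
  d K + d (swap K i) = \prod_(j in ~: K :\ bar i) m j.
Hypothesis d_dC : forall K, lagrangian K -> d K * d (~: K) = 0.

Definition spanned q := exists s : vertex n -> HBT n,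
  q = \sum_v phi (s v) * schubert v.

Lemma spannedD p q : spanned p -> spanned q -> spanned (p + q).
Proof.
move=> [s ->] [t ->]; exists (fun v => s v + t v).
by rewrite -big_split; apply: eq_bigr => v _; rewrite rmorphD mulrDl.
Qed.

Lemma spannedZ a q : spanned q -> spanned (phi a * q).
Proof.
move=> [s ->]; exists (fun v => a * s v).
by rewrite mulr_sumr; apply: eq_bigr => v _; rewrite rmorphM mulrA.
Qed.

Lemma spannedB p q : spanned p -> spanned q -> spanned (p - q).
Proof.
move=> hp hq; rewrite -mulN1r -(rmorph1 phi) -rmorphN.
exact/spannedD/spannedZ.
Qed.

Lemma spanned0 : spanned 0.
Proof.
by exists (fun _ => 0); rewrite big1 // => v _; rewrite rmorph0 mul0r.
Qed.

Lemma spanned_schubert e : (e < 2 * n + 2)%N -> spanned (schubert e).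
Proof.
move=> e_n; exists (fun v => (v == e :> nat)%:R).
rewrite (bigD1 (vtx n e)) //= -[nat_of_ord _]/(nat_of_ord (vtx n e)) vtxK //.
rewrite eqxx rmorph1 mul1r big1 ?addr0 // => v.
rewrite -(inj_eq (@ord_inj _)) vtxK // => /negbTE ->.
by rewrite rmorph0 mul0r.
Qed.

Lemma spanned1 : spanned 1.
Proof.
have -> : 1 = schubert 0 by rewrite /schubert /= big_pred0_eq.
by apply: spanned_schubert; lia.
Qed.

Lemma spannedM q r :
  (forall v, spanned (schubert v * r)) -> spanned q -> spanned (q * r).
Proof.
move=> hr [s ->]; rewrite mulr_suml; elim/big_ind: _ => [||v _].
- exact: spanned0.
- exact: spannedD.
- by rewrite -mulrA; apply: spannedZ.
Qed.

(** All [m i] agree up to scalars, so each class need only be multiplied by one conveniently chosen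
    [m j]. *)
Lemma mE i j : m i = m j + phi (f i - f j).
Proof. by rewrite phi_f addrC subrK. Qed.

Lemma spanned_upperM v : (n < v)%N -> spanned (d (upper n v) * m v).
Proof.
move=> n_v; have v_n := ltn_ord v.
have [v_max|v_lt] := eqVneq (nat_of_ord v) (2 * n + 1)%N.
  have -> : upper n v = [set v].
    apply/setP => w; rewrite !inE -(inj_eq (@ord_inj _)) v_max.
    by have := ltn_ord w; lia.
  by rewrite d1M; apply: spanned0.
rewrite dM ?upper_star // ?upperD1.
  have -> : d (upper n v.+1) = schubert v.+1 by rewrite /schubert ifN //; lia.
  by apply: spanned_schubert; lia.
rewrite properE sub1set in_upper leqnn /=; apply/subsetPn.
exists (vtx n v.+1); first by rewrite in_upper vtxK; lia.
by rewrite inE -(inj_eq (@ord_inj _)) vtxK; lia.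
Qed.

(** The passage between the two kinds of classes: multiplying by [m v] at [v = n] does not simply
    give the next class, so relation (3) first splits the product into two [d] terms. *)
Lemma spanned_middleM v : v = n :> nat -> spanned (schubert v * m v).
Proof.
move=> vn; pose K := upper n n.+1; have lK : lagrangian K := upper_lagrangian n.
pose w := bar v; have wn : w = n.+1 :> nat by rewrite /= vn; lia.
have wK : w \in K by rewrite in_upper wn.
(* The complement of [K] is the set of vertices up to [n], and [bar w] is [n] itself, which leaves
   the factors below [n]. *)
have -> : schubert v = d K + d (swap K w).
  rewrite /schubert vn leqnn d_swap //; apply: eq_bigl => k.
  by rewrite !inE /w barK -(inj_eq (@ord_inj _)) vn; lia.
have upE : K :\ w = upper n n.+2 by rewrite /K -wn upperD1.
have swE : swap K w :\ v = upper n n.+2.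
  rewrite -upE /swap /w barK setU1K // !inE -(inj_eq (@ord_inj _)) /=.
  by rewrite vn; lia.
have vS : v \in swap K w.
  by rewrite in_swap // /w barK eqxx orbT addbT in_upper vn; lia.
have sp2 : spanned (d (upper n n.+2)).
  have -> : d (upper n n.+2) = schubert n.+2 by rewrite /schubert ifN //; lia.
  by apply: spanned_schubert; lia.
rewrite mulrDl; apply: spannedD; last first.
  rewrite dM ?swE // ?lagrangian_star ?swap_lagrangian //.
  rewrite properE sub1set vS /=; apply/subsetPn; exists (vtx n n.+2).
    have : vtx n n.+2 \in swap K w :\ v by rewrite swE in_upper vtxK; lia.
    by case/setD1P.
  by rewrite inE -(inj_eq (@ord_inj _)) vtxK; lia.
(* Since [v] is not in [K], relation (4) does not apply to [d K * m v]; replacing [m v] by [m w]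
   costs a scalar multiple of [d K]. *)
rewrite (mE v w) mulrDr; apply: spannedD; last first.
  rewrite mulrC; apply: spannedZ.
  have -> : d K = schubert n.+1 by rewrite /schubert ifN //; lia.
  by apply: spanned_schubert; lia.
by have := @spanned_upperM w; rewrite wn; apply.
Qed.

Lemma spanned_schubertM v i : spanned (schubert v * m i).
Proof.
rewrite (mE i v) mulrDr; apply: spannedD; last first.
  by rewrite mulrC; apply/spannedZ/spanned_schubert.
have [v_n|n_v|/spanned_middleM//] := ltngtP v n; last first.
  by rewrite /schubert ifN -?ltnNge //; apply: spanned_upperM.
have -> : schubert v * m v = schubert v.+1; last first.
  by apply: spanned_schubert; lia.
rewrite /schubert v_n ltnW // [RHS](bigD1 v) //= mulrC; congr (_ * _).
by apply: eq_bigl => k; rewrite -(inj_eq (@ord_inj _)); lia.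
Qed.

Lemma spanned_m q i : spanned q -> spanned (q * m i).
Proof. by apply: spannedM => v; apply: spanned_schubertM. Qed.

Lemma spanned_prod_m q (A : pred (vertex n)) :
  spanned q -> spanned (q * \prod_(i | A i) m i).
Proof.
move=> hq; elim/big_rec: _ => [|i p _ hp]; first by rewrite mulr1.
by rewrite mulrCA mulrC; apply: spanned_m.
Qed.

Lemma spanned_d_lagrangian q : spanned (q * d (upper n n.+1)) -> spanned q ->
  forall K, lagrangian K -> spanned (q * d K).
Proof.
move=> hq0 hq.
apply: (lagrangian_swap_ind (upper_lagrangian n)) => // K i lK iK hK.
have -> : d K = \prod_(j in ~: K :\ bar i) m j - d (swap K i).
  by rewrite -d_swap // addrK.
by rewrite mulrBr; apply: spannedB => //; apply: spanned_prod_m.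
Qed.

(** Relation (4), iterated over the elements of [L] missing from [K]. *)
Lemma d_subset K L : star K -> lagrangian L -> K \subset L ->
  d K = d L * \prod_(i in L :\: K) m i.
Proof.
move=> sK /lagrangian_star sL; have [e] := ubnP #|L :\: K|.
elim: e K sK => // e IH K sK cLK KL.
have [LK|[i iLK]] := set_0Vmem (L :\: K).
  have /eqP -> : K == L by rewrite eqEsubset KL -setD_eq0 LK eqxx.
  by rewrite setDv big_set0 mulr1.
have /setDP[iL iK] := iLK.
have iKL : i |: K \subset L by rewrite subUset sub1set iL.
have s' : star (i |: K).
  apply/starP; split; first by apply/set0Pn; exists i; rewrite setU11.
  move=> j /(subsetP iKL) jL; apply: contra (proj2 (starP _ sL) j jL).
  exact: (subsetP iKL).
have LKE : L :\: (i |: K) = (L :\: K) :\ i by rewrite setDDl setUC.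
have -> : d K = d (i |: K) * m i.
  rewrite dM ?setU1K // properE sub1set setU11 /=; apply/subsetPn.
  have [/set0Pn[j jK] _] := starP _ sK; exists j; first by rewrite setU1r.
  by rewrite inE; apply: contraNneq iK => <-.
rewrite IH // ?LKE; last by rewrite (cardsD1 i) iLK in cLK.
by rewrite (big_setD1 i iLK) /= mulrA mulrAC.
Qed.

Lemma spanned_mul_d q : spanned q ->
  (forall L, lagrangian L -> spanned (q * d L)) ->
  forall K, star K -> spanned (q * d K).
Proof.
move=> hq h K sK; have [L lL KL] := star_sub_lagrangian sK.
by rewrite (d_subset sK lL KL) mulrA; apply/spanned_prod_m/h.
Qed.

Lemma d_upper_lagrangian : d (upper n n.+1) = schubert n.+1.
Proof. by rewrite /schubert ifN // -ltnNge. Qed.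

Lemma spanned_d1 K : star K -> spanned (d K).
Proof.
move=> sK; rewrite -[d K]mul1r; apply: spanned_mul_d => //.
  exact: spanned1.
apply: spanned_d_lagrangian; last exact: spanned1.
by rewrite mul1r d_upper_lagrangian; apply: spanned_schubert; lia.
Qed.

(** [L] may be taken Lagrangian. Swap induction then starts at [~: K], where the product is 0, and
    each exchange adds only a multiple of [d K] by a product of [m j]. *)
Lemma spanned_dd K L : lagrangian K -> star L -> spanned (d K * d L).
Proof.
move=> lK; apply: spanned_mul_d; first exact/spanned_d1/lagrangian_star.
apply: (lagrangian_swap_ind (lagrangianC lK)).
  by rewrite d_dC //; apply: spanned0.
move=> L' i lL' iL' hs.
have -> : d L' = \prod_(j in ~: L' :\ bar i) m j - d (swap L' i).
  by rewrite -d_swap // addrK.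
rewrite mulrBr; apply: spannedB => //; apply: spanned_prod_m.
exact/spanned_d1/lagrangian_star.
Qed.

Lemma spanned_dM q K : star K -> spanned q -> spanned (q * d K).
Proof.
move=> sK; apply: spannedM => v; rewrite /schubert mulrC; case: leqP => v_n.
  by apply/spanned_prod_m/spanned_d1.
have sU : star (upper n v) by apply: upper_star.
rewrite mulrC; apply: spanned_mul_d => //; first exact: spanned_d1.
by move=> L lL; rewrite mulrC; apply: spanned_dd.
Qed.

End Spanning.

Lemma rmorph_schubert n (Q Q' : comNzRingType) (psi : {rmorphism Q -> Q'})
    (m : vertex n -> Q) (d : {set vertex n} -> Q) e :
  psi (schubert m d e) = schubert (psi \o m) (psi \o d) e.
Proof. by rewrite /schubert; case: ifP => // _; rewrite rmorph_prod. Qed.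

(** * The Schubert-like functions form a basis of the graph cohomology *)

Section Triangular.
Variable n : nat.
Implicit Types (i j k v w : vertex n).

Definition schubert_fun v j : HBT n :=
  schubert (fun k => f k - f j) (fun K => Dfun K j) v.

Lemma schubert_fun_lt v j : (j < v)%N -> schubert_fun v j = 0.
Proof.
rewrite /schubert_fun /schubert => jv; case: leqP => v_n.
  by rewrite (bigD1 j) //= subrr mul0r.
by rewrite DfunE in_upper leqNgt jv.
Qed.

Lemma schubert_fun_diag v :
  schubert_fun v v
  = \prod_(k in [set k : vertex n | (k < v)%N & k != bar v]) (f k - f v).
Proof.
rewrite /schubert_fun /schubert; case: leqP => v_n.
  apply: eq_bigl => k; rewrite inE -(inj_eq (@ord_inj _)) /=.
  by have := ltn_ord v; lia.
rewrite DfunE in_upper leqnn; apply: eq_bigl => k.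
by rewrite !inE -ltnNge andbC.
Qed.

(** Each of these functions evaluates a polynomial in the generators, so it inherits the congruence
    from [ev_gkm]. *)
Lemma schubert_fun_gkm v i j : edge i j ->
  exists q, schubert_fun v i - schubert_fun v j = q * alpha i j.
Proof.
move=> ij.
suff H k : schubert_fun v k = ev k (schubert (@Mvar n) (@Dvar n) v).
  have [q hq] := ev_gkm (schubert (@Mvar n) (@Dvar n) v) ij.
  by exists q; rewrite !H.
rewrite rmorph_schubert /schubert_fun /schubert; case: leqP => v_n.
  by apply: eq_bigr => l _ /=; rewrite ev_Mvar.
by rewrite /= ev_Dvar ?upper_star.
Qed.

(** Evaluating at [v] kills the later classes, induction kills the earlier coefficients, and the
    diagonal value is nonzero because [f] is injective. *)
Lemma schubert_fun_free (s : vertex n -> HBT n) :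
  (forall j, \sum_v s v * schubert_fun v j = 0) -> forall v, s v = 0.
Proof.
move=> h v; have [e] := ubnP (nat_of_ord v); elim: e v => // e IH v ve.
have := h v; rewrite (bigD1 v) //= big1 => [|w wv].
  rewrite addr0 => /eqP; rewrite mulf_eq0 => /orP[/eqP//|].
  rewrite schubert_fun_diag prodf_seq_eq0 => /hasP[k _ /andP[]].
  rewrite inE subr_eq0 (inj_eq (@f_inj n)) => /andP[kv _] /eqP kE.
  by rewrite kE ltnn in kv.
case: (ltngtP w v) => [w_v|w_v|/ord_inj wE].
- by rewrite IH ?mul0r //; lia.
- by rewrite schubert_fun_lt ?mulr0.
- by rewrite wE eqxx in wv.
Qed.

(** Elimination vertex by vertex: a remainder vanishing below [v] is divisible at [v] by every
    weight towards a smaller neighbour, hence by their product, the diagonal value. *)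
Lemma schubert_fun_span (h : vertex n -> HBT n) :
  (forall i j, edge i j -> exists q, h i - h j = q * alpha i j) ->
  exists s : vertex n -> HBT n, forall j, h j = \sum_v s v * schubert_fun v j.
Proof.
move=> hg; suff H e : exists s : vertex n -> HBT n,
    forall j, (j < e)%N -> h j = \sum_v s v * schubert_fun v j.
  by have [s hs] := H (2 * n + 2)%N; exists s => j; apply: hs.
elim: e => [|e [s hs]]; first by exists (fun _ => 0).
have [e_n|e_n] := ltnP e (2 * n + 2); last first.
  by exists s => j _; apply: hs; apply: leq_trans e_n.
pose v := vtx n e; have vE : v = e :> nat by rewrite vtxK.
pose h' j := h j - \sum_w s w * schubert_fun w j.
have [|k|q hq] := @prod_f_sub_dvd n v
    [set k : vertex n | (k < v)%N & k != bar v] (h' v).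
- move=> k; rewrite inE => /andP[kv ->]; split=> //.
  by apply: contraTneq kv => ->; rewrite ltnn.
- rewrite inE => /andP[kv kb]; have vk : edge v k.
    by rewrite /edge kb andbT; apply: contraTneq kv => ->; rewrite ltnn.
  have [q hq] := hg _ _ vk.
  have [r hr] : exists r, \sum_w s w * schubert_fun w v
      - \sum_w s w * schubert_fun w k = r * alpha v k.
    rewrite -sumrB; elim/big_ind: _ => [|_ _ [a ->] [b ->]|w _].
    - by exists 0; rewrite mul0r.
    - by exists (a + b); rewrite mulrDl.
    - have [a ha] := schubert_fun_gkm w vk; exists (s w * a).
      by rewrite -mulrBr ha mulrA.
  (* As [k] lies below [e], the remainder vanishes there, so its difference along the edge is [h' v]
     itself. *)
  exists (q - r); rewrite mulrBl -hq -hr /h' -(hs k); first by ring.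
  by rewrite -vE.
(* Only the coefficient at [v] changes, which leaves the values below [v] untouched. *)
exists (fun w => s w + (if w == v then q else 0)) => j je.
under eq_bigr do rewrite mulrDl.
rewrite big_split /= [X in _ + X](bigD1 v) //= eqxx.
rewrite [X in _ + (_ + X)]big1 => [|w wv]; last first.
  by rewrite (negbTE wv) mul0r.
rewrite addr0; have [j_e|j_e|j_e] := ltngtP j e; last first.
- have -> : j = v by apply: ord_inj; rewrite vE.
  by rewrite schubert_fun_diag -hq /h' addrC subrK.
- by move: je j_e; lia.
- by rewrite schubert_fun_lt ?vE // mulr0 addr0 hs.
Qed.

End Triangular.

(** * Homomorphisms out of a quotient by an ideal *)

Lemma ideal_quot_lift (R : comNzRingType) (I : idealr R) (S : pzRingType)
    (phi : {rmorphism R -> S}) :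
  (forall p, p \in I -> phi p = 0) ->
  exists psi : {rmorphism {ideal_quot I} -> S},
    forall p, psi (\pi_({ideal_quot I})%qT p) = phi p.
Proof.
move=> phi0; pose psi (c : {ideal_quot I}) := phi (repr c).
have psiE p : psi (\pi_({ideal_quot I})%qT p) = phi p.
  apply/eqP; rewrite -subr_eq0 -rmorphB; apply/eqP/phi0.
  by rewrite Quotient.idealrBE reprK.
have psiB : {morph psi : a b / a - b}.
  by move=> a b; rewrite -[a]reprK -[b]reprK -rmorphB !psiE rmorphB.
have psiM : monoid_morphism psi.
  split=> [|a b].
    by rewrite -(rmorph1 \pi_({ideal_quot I})%qT) psiE rmorph1.
  by rewrite -[a]reprK -[b]reprK -rmorphM !psiE rmorphM.
pose Psi := HB.pack_for {rmorphism {ideal_quot I} -> S} psi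
  (GRing.isZmodMorphism.Build _ _ psi psiB)
  (GRing.isMonoidMorphism.Build _ _ psi psiM).
by exists Psi.
Qed.

(** * The relations in the quotient ring and the map to the graph cohomology *)

Section Presentation.
Variable n : nat.
Hypothesis n_gt0 : (0 < n)%N.
Implicit Types (i j k v w : vertex n) (K L : {set vertex n}).

Lemma class_relator p : relator p -> class p = 0 :> ZGQ n.
Proof.
move=> rp; rewrite /class -[RHS](rmorph0 \pi_({ideal_quot (@IGQ n)})%qT).
apply/eqP; rewrite -Quotient.idealrBE subr0; apply/asboolP.
exists [:: (1, p)]; split; last by rewrite big_seq1 mul1r.
by move=> t; rewrite inE => /eqP->.
Qed.

Lemma classB p q : class (p - q) = class p - class q :> ZGQ n.
Proof. exact: rmorphB. Qed.

Lemma classD p q : class (p + q) = class p + class q :> ZGQ n.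
Proof. exact: rmorphD. Qed.

Lemma classM p q : class (p * q) = class p * class q :> ZGQ n.
Proof. exact: rmorphM. Qed.

Lemma class_prod (A : pred (vertex n)) (F : vertex n -> ZMD n) :
  class (\prod_(i | A i) F i) = \prod_(i | A i) class (F i) :> ZGQ n.
Proof. exact: rmorph_prod. Qed.

Lemma class_eq p q : relator (p - q) -> class p = class q :> ZGQ n.
Proof. by move=> /class_relator/eqP; rewrite classB subr_eq0 => /eqP. Qed.

Let m v : ZGQ n := class (Mvar v).
Let d K : ZGQ n := class (Dvar K).

Lemma class_M_bar i j : m i + m (bar i) = m j + m (bar j).
Proof.
have [->//|ij] := eqVneq i j.
by rewrite -!classD; apply/class_eq/Rel2.
Qed.

Lemma class_DM K i : star K -> [set i] \proper K -> d K * m i = d (K :\ i).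
Proof. by move=> sK iK; rewrite -classM; apply/class_eq/Rel4. Qed.

Lemma star_set1 i : star [set i].
Proof.
apply/starP; split=> [|j /set1P->]; last by rewrite inE bar_neq.
by apply/set0Pn; exists i; rewrite inE.
Qed.

Lemma class_D1M i : d [set i] * m i = 0.
Proof.
rewrite -classM /Dvar insubT ?star_set1 // => s1.
have := @Rel1 n [:: inr (Sub [set i] s1); inl i] isT.
rewrite !big_cons !big_nil mulr1 /= setIT => h.
by apply/class_relator/h; rewrite setICr.
Qed.

Lemma class_DDC K : lagrangian K -> d K * d (~: K) = 0.
Proof.
move=> lK; have sK := lagrangian_star lK.
have sC := lagrangian_star (lagrangianC lK).
rewrite -classM /Dvar !insubT.
have := @Rel1 n [:: inr (Sub K sK); inr (Sub (~: K) sC)] isT.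
rewrite !big_cons !big_nil mulr1 /= setIT => h.
by apply/class_relator/h; rewrite setICr.
Qed.

Lemma class_D_swap K i : lagrangian K -> i \in K ->
  d K + d (swap K i) = \prod_(j in ~: K :\ bar i) m j.
Proof.
move=> lK iK; have /lagrangianP lK' := lK.
pose I := ~: K :\ bar i.
have biC : bar i \in ~: K by rewrite inE lK' iK.
have cI : #|I| = n.
  have := lagrangian_card (lagrangianC lK).
  by rewrite (cardsD1 (bar i)) biC add1n => -[].
have sI : star I.
  apply/starP; split=> [|j]; first by rewrite -card_gt0 cI.
  by rewrite !inE lK' => /andP[_ jK]; rewrite jK andbF.
have iI : [set bar i; bar (bar i)] \subset ~: I.
  by rewrite barK subUset !sub1set !inE eqxx iK andbF.
have [_ _ _] := Rel3_lagrangian sI cI iI.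
have -> : ~: (I :|: [set bar i]) = K by rewrite setUC setD1K // setCK.
rewrite barK => swE; have /class_eq := Rel3 sI cI iI.
by rewrite class_prod classD barK setUC setD1K // setCK swE => ->.
Qed.

(** Relation (2) is the constancy that [HBT_hom] asks for; it makes the quotient ring an algebra
    over [HBT n]. *)
Lemma scalars_exist :
  exists phi : {rmorphism HBT n -> ZGQ n},
    forall i, phi (f i) = m i - m (vtx n n.+1).
Proof. by apply: (HBT_hom (c := _)) => i; apply: (class_M_bar i (vtx n 0)). Qed.

(** The span contains 1 and is stable under multiplication by every generator, hence by every
    class. *)
Lemma ZGQ_spanned (phi : {rmorphism HBT n -> ZGQ n}) :
  (forall i, phi (f i) = m i - m (vtx n n.+1)) ->
  forall c : ZGQ n, spanned m d phi c.
Proof.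
move=> phif; have phiB i j : phi (f i - f j) = m i - m j.
  by rewrite rmorphB !phif opprB addrA subrK.
have dM := @spanned_dM n _ m d phi n_gt0 phiB
  class_DM class_D1M class_D_swap class_DDC.
have mM := @spanned_m n _ m d phi n_gt0 phiB class_DM class_D1M class_D_swap.
have h p : forall q, spanned m d phi q -> spanned m d phi (q * class p).
  elim/mpoly_int_ind: p => [|p r hp hr|p r hp hr|u] q hq.
  - by rewrite [class _]rmorph1 mulr1.
  - by rewrite classB mulrBr; apply: spannedB; [apply: hp|apply: hr].
  - by rewrite classM mulrA; apply/hr/hp.
  - have -> : 'X_u = var (enum_val u) :> ZMD n by rewrite /var enum_valK.
    case: (enum_val u) => [v|[K sK]]; first exact: mM.
    by have := dM q K sK hq; rewrite /d /Dvar insubT.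
move=> c; have -> : c = class (repr c) by rewrite /class reprK.
rewrite -[class _]mul1r; apply: h.
exact: spanned1.
Qed.

Lemma psi_exists : exists psi : {rmorphism ZGQ n -> HGQ n},
  forall p j, HGQ_val (psi (class p)) j = ev j p.
Proof.
pose F p : cochain n := [ffun j => ev j p].
have F_gkm p : F p \in @gkm n.
  by apply/asboolP => i j ij; rewrite !ffunE; apply: ev_gkm.
pose G p := MkHGQ (F_gkm p).
have GB : {morph G : p q / p - q}.
  by move=> p q; apply: val_inj; apply/ffunP => j; rewrite !ffunE rmorphB.
have GM : monoid_morphism G.
  by split=> [|p q]; apply: val_inj; apply/ffunP => j;
    rewrite !ffunE ?rmorph1 ?rmorphM.
pose Phi := HB.pack_for {rmorphism ZMD n -> HGQ n} G
  (GRing.isZmodMorphism.Build _ _ G GB) (GRing.isMonoidMorphism.Build _ _ G GM).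
have [p|psi psiE] := @ideal_quot_lift _ (@IGQ n) _ Phi.
  move=> /asboolP[s [sr ->]]; apply: val_inj; apply/ffunP => j; rewrite !ffunE.
  rewrite rmorph_sum big_seq big1 // => t /sr tr.
  by rewrite rmorphM (ev_relator n_gt0 j tr) mulr0.
by exists psi => p j; rewrite psiE ffunE.
Qed.

Lemma psi_coord_exists j : exists psi : {rmorphism ZGQ n -> HBT n},
  forall p, psi (class p) = ev j p.
Proof.
have [p|psi psiE] := @ideal_quot_lift _ (@IGQ n) _ (ev j); last by exists psi.
move=> /asboolP[s [sr ->]].
rewrite rmorph_sum big_seq big1 // => t /sr tr.
by rewrite rmorphM (ev_relator n_gt0 j tr) mulr0.
Qed.

(** Evaluation is linear over [HBT n]: [psi] undoes [phi], since [phi (f i)] evaluates to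
    [f i - f (vtx n n.+1)] and the last term is 0. *)
Lemma psi_coord_schubert (phi : {rmorphism HBT n -> ZGQ n})
    (psi : {rmorphism ZGQ n -> HBT n}) j (s : vertex n -> HBT n) :
  (forall i, phi (f i) = m i - m (vtx n n.+1)) ->
  (forall p, psi (class p) = ev j p) ->
  psi (\sum_v phi (s v) * schubert m d v) = \sum_v s v * schubert_fun v j.
Proof.
move=> phif psiE; rewrite rmorph_sum; apply: eq_bigr => v _.
rewrite rmorphM; congr (_ * _).
  elim/HBT_ind: (s v) => [|p q hp hq|p q hp hq|i].
  - by rewrite !rmorph1.
  - by rewrite !rmorphB hp hq.
  - by rewrite !rmorphM hp hq.
  - rewrite phif rmorphB !psiE !ev_Mvar f_vtx_succ; ring.
rewrite rmorph_schubert /schubert_fun /schubert; case: leqP => v_n.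
  by apply: eq_bigr => k _ /=; rewrite psiE ev_Mvar.
by rewrite /= psiE ev_Dvar ?upper_star.
Qed.

End Presentation.

(** * Bijectivity, by comparing coordinates in the two families of Schubert-like classes *)

Theorem theorem5p1 (n : nat) (hn : (1 <= n)%N) :
  exists psi : {rmorphism ZGQ n -> HGQ n},
    [/\ forall v : vertex n, HGQ_val (psi (class (Mvar v))) = Mfun v,
        forall K : {set vertex n}, star K ->
          HGQ_val (psi (class (Dvar K))) = Dfun K
      & bijective psi].
Proof.
have [psi psiE] := psi_exists hn; exists psi; split=> [v|K sK|].
- by apply/ffunP => j; rewrite psiE ev_Mvar MfunE.
- by apply/ffunP => j; rewrite psiE ev_Dvar.
have [phi phif] := scalars_exist n.
have psi_schubert (s : vertex n -> HBT n) j :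
    HGQ_val (psi (\sum_v phi (s v) * schubert
    (fun v => class (Mvar v)) (fun K => class (Dvar K)) v)) j
    = \sum_v s v * schubert_fun v j.
  have [psi_j psi_jE] := psi_coord_exists hn j.
  rewrite -(psi_coord_schubert s phif psi_jE).
  set c := \sum_v _; have -> : c = class (repr c) by rewrite /class reprK.
  by rewrite psiE psi_jE.
have psi_inj : injective psi.
  apply: raddf_inj => c; have [s ->] := ZGQ_spanned hn phif c.
  move=> psi0; rewrite big1 // => v _.
  rewrite (@schubert_fun_free n s) ?rmorph0 ?mul0r // => j.
  by rewrite -psi_schubert psi0 ffunE.
have psi_surj h : exists c, psi c = h.
  have [|s hs] := @schubert_fun_span n (HGQ_val h).
    by have /asboolP := HGQ_valP h.
  exists (\sum_v phi (s v) * schubert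
    (fun v => class (Mvar v)) (fun K => class (Dvar K)) v).
  by apply: val_inj; apply/ffunP => j; rewrite psi_schubert hs.
exists (fun h => sval (cid (psi_surj h))) => [c|h].
  by apply: psi_inj; exact: (svalP (cid (psi_surj (psi c)))).
exact: (svalP (cid (psi_surj h))).
Qed.
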